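(* Let $N\ge2$, $D\ge1$ be integers and let $H(D,N)$ be the Hamming graph. For $x\in\mathbb R$ the following are equivalent: (1) $x\in[-1/(N-1),1]$; (2) the function $f_x(i)=x^i$ ($i\in X=\{0,1,\dots,D\}$) is positive definite on the polynomial hypergroup $(X,* )$ associated with $H(D,N)$; (3) the kernel $Q_x(u,v)=x^{d(u,v)}$ (with $0^0=1$) is positive semidefinite on the vertex set of $H(D,N)$.
   Context: The Hamming graph $H(D,N)$ has vertex set $V=\{1,\dots,N\}^D$, two vertices adjacent iff they differ in exactly one coordinate; its distance is $d(u,v)=|\{i: u_i\ne v_i\}|$ and its diameter is $D$. It is distance-regular: for $i,j,k\in X$ the number $p_{i,j}^k=|\{z: d(x,z)=i,\ d(y,z)=j\}|$ is the same for all $x,y$ with $d(x,y)=k$. Let $\omega_k=p_{k,k}^0$ and $\tilde p_{i,j}^k=\frac{\omega_k}{\omega_i\omega_j}p_{i,j}^k$. The associated polynomial hypergroup $(X,* )$ is $X$ with convolution $\delta_i*\delta_j=\sum_k\tilde p_{i,j}^k\delta_k$. For $f:X\to\mathbb C$ write $f(i*j)=\sum_k\tilde p_{i,j}^kf(k)$; $f$ is positive definite on $(X,* )$ if $\sum_{k,l=1}^nc_k\bar c_lf(x_k*x_l)\ge0$ for all $n$, $x_k\in X$, $c_k\in\mathbb C$. A kernel $Q$ on $V$ is positive semidefinite if $\sum_{i,j}c_i\bar c_jQ(u_i,u_j)\ge0$ for all finite families of vertices $u_i$ and complex $c_i$. *)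

(* Defs.v *)
From HB Require Import structures.
From mathcomp Require Export all_boot all_order all_algebra all_fingroup.
From mathcomp Require Export reals.
From mathcomp Require Export complex.

Set Implicit Arguments.
Unset Strict Implicit.
Unset Printing Implicit Defensive.

Import Order.TTheory GRing.Theory Num.Theory.
Local Open Scope ring_scope.
Local Open Scope complex_scope.

Definition hvertex (D N : nat) : finType := {ffun 'I_D -> 'I_N}.

Definition hdist (D N : nat) (u v : hvertex D N) : nat :=
  #|[set i | u i != v i]|.

Definition hadj (D N : nat) : rel (hvertex D N) :=
  fun u v => hdist u v == 1%N.

(* The number p_{i,j}^k, read off an arbitrary pair of vertices at distance k;
   it is 0 if there is no such pair. Independence of the chosen pair is
   [inter_numE]. *)
Definition inter_num (D N i j k : nat) : nat :=
  if [pick xy : hvertex D N * hvertex D N | hdist xy.1 xy.2 == k] is Some xy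
  then #|[set z | hdist xy.1 z == i & hdist xy.2 z == j]|
  else 0%N.

Definition omega (D N k : nat) : nat := inter_num D N k k 0.

Definition tilde_p (R : realType) (D N i j k : nat) : R :=
  (omega D N k)%:R / ((omega D N i)%:R * (omega D N j)%:R)
  * (inter_num D N i j k)%:R.

(* f(i * j), i.e. f integrated against delta_i * delta_j. *)
Definition hconv (R : realType) (D N : nat) (f : 'I_D.+1 -> R[i])
    (i j : 'I_D.+1) : R[i] :=
  \sum_(k < D.+1) (tilde_p R D N i j k)%:C * f k.

(* On R[i], [0 <= z] means that z is real and nonnegative. *)
Definition hg_posdef (R : realType) (D N : nat) (f : 'I_D.+1 -> R[i]) : Prop :=
  forall (n : nat) (x : 'I_n -> 'I_D.+1) (c : 'I_n -> R[i]),
    0 <= \sum_(k < n) \sum_(l < n)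
           c k * (c l)^* * hconv N f (x k) (x l).

Definition kernel_psd (R : realType) (V : Type) (Q : V -> V -> R[i]) : Prop :=
  forall (n : nat) (u : 'I_n -> V) (c : 'I_n -> R[i]),
    0 <= \sum_(k < n) \sum_(l < n) c k * (c l)^* * Q (u k) (u l).

Lemma hdist_sym (D N : nat) (u v : hvertex D N) : hdist u v = hdist v u.
Proof. by apply: eq_card => i; rewrite !inE eq_sym. Qed.

Lemma hdist_eq0 (D N : nat) (u v : hvertex D N) : (hdist u v == 0%N) = (u == v).
Proof.
rewrite cards_eq0; apply/eqP/eqP => [h|->]; last first.
  by apply/setP => i; rewrite !inE eqxx.
by apply/ffunP => i; have /setP/(_ i) := h; rewrite !inE => /negbFE/eqP.
Qed.

Lemma hdist_triangle (D N : nat) (u v w : hvertex D N) :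
  (hdist u w <= hdist u v + hdist v w)%N.
Proof.
apply: leq_trans (leq_card_setU _ _).
apply/subset_leq_card/subsetP => i; rewrite !inE -negb_and.
by apply: contra => /andP[/eqP-> /eqP->].
Qed.

(* [hdist] is the graph distance of [hadj]: no walk from u to v is shorter than
   hdist u v, and some walk has exactly that length. *)
Lemma hdist_walk_ge (D N : nat) (u : hvertex D N) (p : seq (hvertex D N)) :
  path (@hadj D N) u p -> (hdist u (last u p) <= size p)%N.
Proof.
elim: p u => [|v p IH] u /=; first by move=> _; rewrite leqn0 hdist_eq0.
case/andP=> /eqP uv /IH vp.
by apply: leq_trans (hdist_triangle u v _) _; rewrite uv ltnS.
Qed.

Lemma hdist_walk_ex (D N : nat) (u v : hvertex D N) :
  exists p, [/\ path (@hadj D N) u p, last u p = v & size p = hdist u v].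
Proof.
move en: (hdist u v) => n; elim: n u en => [|n IH] u en.
  by exists [::]; split=> //=; apply/eqP; rewrite -hdist_eq0 en.
have /card_gt0P [m] : (0 < #|[set i | u i != v i]|)%N by rewrite -/(hdist u v) en.
rewrite inE => um.
pose w : hvertex D N := [ffun j => if j == m then v m else u j].
have uw : hdist u w = 1%N.
  rewrite -(cards1 m); apply: eq_card => j; rewrite !inE ffunE.
  by case: (eqVneq j m) => [->|]; rewrite // eqxx.
have wv : hdist w v = n.
  have := en; rewrite /hdist (cardsD1 m) inE um /= => -[<-].
  apply: eq_card => j; rewrite !inE ffunE.
  by case: (eqVneq j m) => [->|]; rewrite // eqxx.
have [p [pp lp sp]] := IH _ wv.
by exists (w :: p); rewrite /= /hadj uw eqxx sp.
Qed.

Lemma hdist_automorphism (D N : nat) (x y x' y' : hvertex D N) :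
  hdist x y = hdist x' y' ->
  exists h : hvertex D N -> hvertex D N,
    [/\ h x' = x, h y' = y & forall u v, hdist (h u) (h v) = hdist u v].
Proof.
move=> exy.
pose s (u v : hvertex D N) := [tuple u i != v i | i < D].
have cs u v : count_mem true (s u v) = hdist u v.
  rewrite /hdist cardsE cardE /enum_mem size_filter /= count_map.
  by rewrite enumT; apply: eq_count => i /=; rewrite eqb_id.
have /tuple_permP[p /= es] : perm_eq (s x y) (s x' y').
  have cf (t : D.-tuple bool) : count_mem false t = (D - count_mem true t)%N.
    have := size_tuple t; rewrite -(count_predC (pred1 true) t) => eD.
    by rewrite -[X in (X - _)%N]eD addKn; apply: eq_count => -[].
  by apply/allP => b _; apply/eqP; case: b; rewrite ?cf !cs exy.
have ep i : (x i == y i) = (x' (p i) == y' (p i)).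
  apply: negb_inj; have /(congr1 (fun t => tnth t i)) :
     s x y = [tuple tnth (s x' y') (p i) | i < D] by apply: val_inj.
  by rewrite !tnth_mktuple.
pose t i : {perm 'I_N} := let t1 := tperm (x' (p i)) (x i) in
  (t1 * tperm (t1 (y' (p i))) (y i))%g.
exists (fun z => [ffun i => t i (z (p i))]); split.
- apply/ffunP => i; rewrite ffunE /t permM tpermL.
  have := ep i; case: (eqVneq (x i) (y i)) => [exi /esym/eqP <-|nxy /esym n'].
    by rewrite !tpermL exi.
  rewrite [LHS]tpermD //; last by rewrite eq_sym.
  by rewrite -[X in _ != X](tpermL (x' (p i))) (inj_eq perm_inj) eq_sym n'.
- by apply/ffunP => i; rewrite ffunE /t permM tpermL.
move=> u v; rewrite /hdist -[RHS](on_card_preimset (f := p)); last first.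
  by apply: onW_bij; exists (p^-1)%g; [apply: permK | apply: permKV].
by apply: eq_card => i; rewrite !inE !ffunE (inj_eq perm_inj).
Qed.

Lemma inter_numE (D N i j k : nat) (x y : hvertex D N) :
  hdist x y = k ->
  inter_num D N i j k = #|[set z | hdist x z == i & hdist y z == j]|.
Proof.
rewrite /inter_num => xyk; case: pickP => [[x' y'] /= /eqP e|/(_ (x, y))]; last first.
  by rewrite /= xyk eqxx.
have [h [hx hy hd]] := hdist_automorphism (etrans xyk (esym e)).
have hinj : injective h.
  by move=> u v huv; apply/eqP; rewrite -hdist_eq0 -hd huv hdist_eq0.
rewrite -[RHS](on_card_preimset (f := h)).
  by apply: eq_card => z; rewrite !inE -hx -hy !hd.
exact/onW_bij/injF_bij.
Qed.

(* Main.v *)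
Require Import Defs.
From mathcomp Require Import all_boot all_order all_algebra.
From mathcomp Require Import reals complex.
From mathcomp Require Import ring lra.

Set Implicit Arguments.
Unset Strict Implicit.
Unset Printing Implicit Defensive.

Import Order.TTheory GRing.Theory Num.Theory.
Local Open Scope ring_scope.
Local Open Scope complex_scope.

(** Write J for the all-ones matrix of size N and K = (1 - x) I + x J, whose
    eigenvalues are 1 - x and 1 + (N - 1) x.  The kernel x^d(u,v) is the D-fold
    tensor power of K, so it is a Gram kernel as soon as both eigenvalues are
    nonnegative: (1) implies (3).  Double counting of triangles shows that
    f(i * j) is the mean of f(d(u,v)) over u and v in the spheres of radii i and
    j around a fixed vertex, so testing (3) on functions of the distance to that
    vertex gives (2).  Finally f(0 * j) = f(j), and f(i * 1) is given by the
    intersection array of the graph; the Cauchy-Schwarz inequality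
    f(0 * 1)^2 <= f(0 * 0) f(1 * 1) then reads (1 - x) (1 + (N - 1) x) >= 0,
    which is (1). *)

Section GramKernels.
Variable R : rcfType.
Implicit Types (V : Type) (T I : finType).

Definition real_gram V (K : V -> V -> R) : Prop :=
  exists (S : finType) (g : S -> V -> R),
    forall u v, K u v = \sum_s g s u * g s v.

Lemma real_gram_tensor T I (K : T -> T -> R) :
  real_gram K ->
  real_gram (fun u v : {ffun I -> T} => \prod_i K (u i) (v i)).
Proof.
move=> [S [g Kg]]; exists {ffun I -> S}.
exists (fun (s : {ffun I -> S}) (u : {ffun I -> T}) => \prod_i g (s i) (u i)).
move=> u v; under eq_bigr do rewrite Kg.
by rewrite bigA_distr_bigA; apply: eq_bigr => s _; exact: big_split.
Qed.

Lemma real_gram_nonneg_comb V (a b : R) (K L : V -> V -> R) :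
    0 <= a -> 0 <= b -> real_gram K -> real_gram L ->
  real_gram (fun u v => a * K u v + b * L u v).
Proof.
move=> a_ge0 b_ge0 [S [g Kg]] [T [h Lh]]; exists (S + T)%type.
exists (fun r u => match r with
  | inl s => Num.sqrt a * g s u
  | inr t => Num.sqrt b * h t u
  end) => u v.
rewrite big_sumType /= Kg Lh !mulr_sumr; congr (_ + _); apply: eq_bigr => r _.
  by rewrite mulrACA -expr2 sqr_sqrtr.
by rewrite mulrACA -expr2 sqr_sqrtr.
Qed.

Lemma natr_card_neq0 T (s : T) : #|T|%:R != 0 :> R.
Proof. by rewrite pnatr_eq0 -lt0n; apply/card_gt0P; exists s. Qed.

Lemma real_gram_mean T : real_gram (fun _ _ : T => #|T|%:R^-1).
Proof.
exists T, (fun _ _ => #|T|%:R^-1) => s _.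
have card_neq0 := natr_card_neq0 s.
by rewrite sumr_const -[RHS]mulr_natl mulVKf.
Qed.

Lemma real_gram_centering T :
  real_gram (fun s t : T => (s == t)%:R - #|T|%:R^-1).
Proof.
exists T, (fun r s => (r == s)%:R - #|T|%:R^-1) => s t.
have card_neq0 := natr_card_neq0 s.
have sum_delta (F : T -> R) (w : T) : \sum_r (r == w)%:R * F r = F w.
  under eq_bigr do rewrite mulr_natl mulrb.
  by rewrite -big_mkcond big_pred1_eq.
under [RHS]eq_bigr do rewrite mulrBl.
rewrite sumrB sum_delta -mulr_sumr sumrB.
under eq_bigr do rewrite -[_%:R]mulr1.
rewrite sum_delta sumr_const -[_^-1 *+ _]mulr_natl divff //.
by rewrite subrr mulr0 subr0.
Qed.

(* The spectral decomposition of the matrix: eigenvalue [1 + (n - 1) x] on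
   constants, [1 - x] on their orthogonal complement. *)
Lemma real_gram_equicorrelation T (x : R) :
    0 <= 1 - x -> 0 <= 1 + (#|T|%:R - 1) * x ->
  real_gram (fun s t : T => if s == t then 1 else x).
Proof.
move=> mu_ge0 la_ge0.
have [S [g Kg]] := real_gram_nonneg_comb la_ge0 mu_ge0
  (real_gram_mean T) (real_gram_centering T).
exists S, g => s t; rewrite -Kg.
have card_neq0 := natr_card_neq0 s.
by case: (s == t); rewrite /= ?mulr1n ?mulr0n; field.
Qed.

End GramKernels.

Section PositiveSemidefiniteKernels.
Variables (R : realType) (V : Type).
Implicit Types Q : V -> V -> R[i].

Lemma real_gram_psd (K : V -> V -> R) :
  real_gram K -> kernel_psd (fun u v => (K u v)%:C).
Proof.
move=> [S [g Kg]] n u c.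
rewrite [leRHS](_ : _ = \sum_s (\sum_(k < n) c k * (g s (u k))%:C)
                         * (\sum_(k < n) c k * (g s (u k))%:C)^*).
  by apply: sumr_ge0 => s _; exact: mul_conjC_ge0.
under [RHS]eq_bigr do rewrite rmorph_sum big_distrlr /=.
rewrite [RHS]exchange_big; apply: eq_bigr => k _ /=.
rewrite [RHS]exchange_big; apply: eq_bigr => l _ /=.
rewrite Kg rmorph_sum mulr_sumr; apply: eq_bigr => s _.
have conj_g : ((g s (u l))%:C)^*%R = (g s (u l))%:C := conjc_real _.
by rewrite !rmorphM /= conj_g; ring.
Qed.

Lemma kernel_psd_fin Q (I : finType) (u : I -> V) (c : I -> R[i]) :
  kernel_psd Q -> 0 <= \sum_k \sum_l c k * (c l)^* * Q (u k) (u l).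
Proof.
have sum_enum_val (F : I -> R[i]) : \sum_i F i = \sum_(k < #|I|) F (enum_val k).
  by rewrite (reindex (@enum_val I predT)) //; exact/onW_bij/enum_val_bij.
move=> Qpsd; rewrite sum_enum_val; under eq_bigr do rewrite sum_enum_val.
exact: (Qpsd #|I| (u \o enum_val) (c \o enum_val)).
Qed.

Lemma kernel_psd_cauchy_schwarz Q (u v : V) :
    kernel_psd Q -> 0 < Q u u -> Q v u = (Q u v)^* ->
  Q u v * Q v u <= Q u u * Q v v.
Proof.
move=> Qpsd Quu_gt0 QvuE; rewrite -subr_ge0 -(pmulr_rge0 _ Quu_gt0).
have := Qpsd 2 (fun k => if k == ord0 then u else v)
               (fun k => if k == ord0 then - Q v u else Q u u).
rewrite !big_ord_recl !big_ord0 /= rmorphN QvuE /= conjCK.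
rewrite (geC0_conj (ltW Quu_gt0)) [leRHS](_ : _ =
  Q u u * (Q u u * Q v v - Q u v * (Q u v)^*)) //.
by ring.
Qed.

End PositiveSemidefiniteKernels.

Lemma kernel_psd_congruence (R : realType) (V : finType) (X : Type)
    (Q : V -> V -> R[i]) (w : X -> V -> R[i]) :
    kernel_psd Q ->
  kernel_psd (fun i j => \sum_u \sum_v w i u * (w j v)^* * Q u v).
Proof.
move=> Qpsd n x c.
have := kernel_psd_fin id (fun u => \sum_(k < n) c k * w (x k) u) Qpsd.
rewrite [leRHS](_ : _ = \sum_(k < n) \sum_(l < n) c k * (c l)^* *
  \sum_u \sum_v w (x k) u * (w (x l) v)^* * Q u v) //.
under [RHS]eq_bigr do under eq_bigr do rewrite mulr_sumr.
under [RHS]eq_bigr do rewrite exchange_big /=.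
rewrite [RHS]exchange_big; apply: eq_bigr => u _ /=.
under [RHS]eq_bigr do under eq_bigr do rewrite mulr_sumr.
under [RHS]eq_bigr do rewrite exchange_big /=.
rewrite [RHS]exchange_big; apply: eq_bigr => v _ /=.
rewrite rmorph_sum big_distrlr mulr_suml; apply: eq_bigr => k _ /=.
by rewrite mulr_suml; apply: eq_bigr => l _; rewrite rmorphM /=; ring.
Qed.

Section HammingDistance.
Variables D N : nat.
Implicit Types o u v : hvertex D N.

Lemma hdistE u v : hdist u v = (\sum_i (u i != v i))%N.
Proof. by rewrite /hdist cardsE -sum1_card big_mkcond. Qed.

Lemma hdistxx u : hdist u u = 0%N.
Proof. by apply/eqP; rewrite hdist_eq0. Qed.

Lemma hdist_ltS u v : (hdist u v < D.+1)%N.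
Proof. by rewrite ltnS -[D in leqRHS]card_ord max_card. Qed.

Definition ord_hdist u v : 'I_D.+1 := Ordinal (hdist_ltS u v).

Lemma expr_hdist (R : nzRingType) u v (x : R) :
  x ^+ hdist u v = \prod_i (if u i == v i then 1 else x).
Proof.
rewrite hdistE expr_sum; apply: eq_bigr => i _.
by case: (u i == v i).
Qed.

Definition hupdate o (i : 'I_D) (a : 'I_N) : hvertex D N :=
  [ffun j => if j == i then a else o j].

Lemma hdist_hupdate o v i a :
  (hdist (hupdate o i a) v + (o i != v i) = hdist o v + (a != v i))%N.
Proof.
rewrite !hdistE (bigD1 i) //= [in RHS](bigD1 i) //= ffunE eqxx.
rewrite (eq_bigr (fun j => o j != v j : nat)) => [|j /negbTE ji].
  by rewrite addnC addnA addnAC.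
by rewrite ffunE ji.
Qed.

Lemma hdist1P o u :
  reflect (exists i, exists2 a, a != o i & u = hupdate o i a)
          (hdist o u == 1%N).
Proof.
apply: (iffP idP) => [/cards1P[i ou]|[i [a aoi ->]]]; last first.
  have := hdist_hupdate o o i a; rewrite eqxx hdistxx aoi addn0.
  by rewrite hdist_sym => ->.
have {}ou j : (o j != u j) = (j == i) by have /setP/(_ j) := ou; rewrite !inE.
exists i, (u i); first by rewrite eq_sym ou.
by apply/ffunP => j; rewrite ffunE; case: eqP => [->//|/eqP ji];
  apply/esym/eqP; rewrite -[_ == _]negbK ou.
Qed.

Lemma big_neighbours (T : Type) (idx : T) (op : Monoid.com_law idx) o
    (F : hvertex D N -> T) :
  \big[op/idx]_(u | hdist o u == 1%N) F u =
  \big[op/idx]_i \big[op/idx]_(a | a != o i) F (hupdate o i a).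
Proof.
pose upd (p : 'I_D * 'I_N) := hupdate o p.1 p.2.
pose moves := [set p : 'I_D * 'I_N | p.2 != o p.1].
have upd_inj : {in moves &, injective upd}.
  move=> [i a] [j b]; rewrite !inE /= => aoi _ /ffunP upd_eq.
  have := upd_eq i; rewrite !ffunE eqxx /=; case: eqP => [-> ->//|_ ao].
  by rewrite ao eqxx in aoi.
rewrite pair_big_dep (eq_bigl (fun u => u \in upd @: moves)) => [|u].
  by rewrite big_imset //; apply: eq_bigl => p; rewrite inE.
apply/hdist1P/imsetP => [[i [a aoi ->]]|[[i a]]].
  by exists (i, a); rewrite ?inE.
by rewrite inE => aoi ->; exists i, a.
Qed.

Lemma sum_hupdate (M : nmodType) (F : nat -> M) o v i (k := hdist o v) :
  \sum_(a | a != o i) F (hdist (hupdate o i a) v) =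
  if o i != v i then F k.-1 + F k *+ N.-2 else F k.+1 *+ N.-1.
Proof.
have [ovi|ovi] /= := eqVneq (o i) (v i).
  rewrite (eq_bigr (fun=> F k.+1)) => [|a aoi].
    by rewrite sumr_const cardC1 card_ord.
  by have := hdist_hupdate o v i a; rewrite -ovi eqxx aoi addn0 addn1 => ->.
rewrite (bigD1 (v i)) /= 1?eq_sym //; congr (_ + _).
  by have := hdist_hupdate o v i (v i); rewrite ovi eqxx addn0 addn1 /k => <-.
rewrite (eq_bigr (fun=> F k)) => [|a /andP[_ avi]]; last first.
  by have := hdist_hupdate o v i a; rewrite ovi avi => /addIn ->.
rewrite sumr_const; congr (_ *+ _).
rewrite -[N in RHS]card_ord -(cardC (pred2 (o i) (v i))) card2 ovi /=.
by apply: eq_card => a; rewrite !inE negb_or.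
Qed.

(* The coefficients are the intersection numbers c_k, a_k, b_k of the Hamming
   graph. *)
Lemma sum_neighbours (M : nmodType) (F : nat -> M) o v (k := hdist o v) :
  \sum_(u | hdist o u == 1%N) F (hdist u v) =
  F k.-1 *+ k + F k *+ (k * N.-2) + F k.+1 *+ ((D - k) * N.-1).
Proof.
rewrite big_neighbours; under eq_bigr do rewrite sum_hupdate.
rewrite (bigID (fun i => o i != v i)) /=.
rewrite (eq_bigr (fun=> F k.-1 + F k *+ N.-2)) => [|i -> //].
rewrite [X in _ + X](eq_bigr (fun=> F k.+1 *+ N.-1)) => [|i /negbTE -> //].
have card_neq : #|[pred i | o i != v i]| = k by rewrite /k /hdist cardsE.
have card_eq : #|[pred i | ~~ (o i != v i)]| = (D - k)%N.
  by apply: (canRL (addKn k)); rewrite -{1}card_neq cardC card_ord.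
rewrite !sumr_const card_neq card_eq mulrnDl -!mulrnA.
by rewrite [(N.-2 * _)%N]mulnC [(N.-1 * _)%N]mulnC.
Qed.

Lemma card_sphere k o : #|[set u | hdist o u == k]| = omega D N k.
Proof.
rewrite /omega (inter_numE k k (hdistxx o)).
by apply: eq_card => u; rewrite !inE andbb.
Qed.

Lemma sumr_sphere (M : nmodType) (z : M) k o :
  \sum_(u | hdist o u == k) z = z *+ omega D N k.
Proof. by rewrite sumr_const -(card_sphere k o) cardsE. Qed.

Lemma omega_hdist_gt0 o u : (0 < omega D N (hdist o u))%N.
Proof.
by rewrite -(card_sphere _ o); apply/card_gt0P; exists u; rewrite inE.
Qed.

Lemma ex_hdist k o : (1 < N)%N -> (k <= D)%N -> exists u, hdist o u = k.
Proof.
move=> N_gt1 kD; pose a0 := Ordinal (ltnW N_gt1); pose a1 := Ordinal N_gt1.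
pose other a := if a == a0 then a1 else a0.
have otherP a : a != other a by rewrite /other; case: (eqVneq a a0) => [->|].
exists [ffun i : 'I_D => if (i < k)%N then other (o i) else o i].
rewrite hdistE (eq_bigr (fun i : 'I_D => (i < k)%N : nat)) => [|i _].
  by rewrite -big_mkcond (big_ord_narrow kD) sum1_card card_ord.
by rewrite ffunE; case: (i < k)%N; rewrite ?otherP ?eqxx.
Qed.

Definition origin (N_gt0 : (0 < N)%N) : hvertex D N := [ffun=> Ordinal N_gt0].

Lemma omega_gt0 k : (1 < N)%N -> (k <= D)%N -> (0 < omega D N k)%N.
Proof.
move=> N_gt1 /(ex_hdist (origin (ltnW N_gt1)) N_gt1)[u <-].
exact: omega_hdist_gt0.
Qed.

Lemma omega1 : (0 < N)%N -> omega D N 1 = (D * N.-1)%N.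
Proof.
move=> N_gt0; pose o := origin N_gt0.
rewrite -(card_sphere 1 o) -sum1dep_card.
have := sum_neighbours (fun=> 1%N) o o.
rewrite hdistxx /= subn0 mul0n !mulr0n !add0r => ->; exact: natn.
Qed.

Lemma inter_numC i j k : inter_num D N i j k = inter_num D N j i k.
Proof.
have [/existsP[[u v] /eqP uvk]|no_pair] :=
  boolP [exists p : hvertex D N * hvertex D N, hdist p.1 p.2 == k].
  have vuk : hdist v u = k by rewrite hdist_sym.
  rewrite (inter_numE i j uvk) (inter_numE j i vuk).
  by apply: eq_card => z; rewrite !inE andbC.
by rewrite /inter_num; case: pickP => // p pk; case/existsP: no_pair; exists p.
Qed.

Lemma card_triangles i j k :
  (#|hvertex D N| * (omega D N k * inter_num D N i j k))%N =
  (\sum_u \sum_v \sum_(z : hvertex D N)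
    ([&& hdist u v == k, hdist u z == i & hdist v z == j] : nat))%N.
Proof.
rewrite -sum_nat_const; apply: eq_bigr => u _.
rewrite -(card_sphere k u) -sum1dep_card big_distrl big_mkcond /=.
apply: eq_bigr => v _; case: eqP => [uvk|_]; last by rewrite big1.
by rewrite mul1n (inter_numE i j uvk) -sum1dep_card big_mkcond.
Qed.

(* Both sides count, up to the factor [#|V|], the triangles with side lengths
   i, j, k. *)
Lemma omega_inter_num i j k :
  (omega D N k * inter_num D N i j k = omega D N i * inter_num D N j k i)%N.
Proof.
have [cardV|cardV] := posnP #|hvertex D N|.
  have no_pair a b c : inter_num D N a b c = 0%N.
    by rewrite /inter_num; case: pickP => // p; have /card0_eq/(_ p.1) := cardV.
  by rewrite !no_pair !muln0.
apply/eqP; rewrite -(eqn_pmul2l cardV) !card_triangles; apply/eqP.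
under eq_bigr do rewrite exchange_big /=.
rewrite exchange_big /=; apply: eq_bigr => z _.
apply: eq_bigr => u _; apply: eq_bigr => v _.
by rewrite andbC -andbA !(hdist_sym z).
Qed.

Lemma sum_sphere_hdist (M : nmodType) (F : 'I_D.+1 -> M) (i j : nat) o u :
  hdist o u = i ->
  \sum_(v | hdist o v == j) F (ord_hdist u v) =
  \sum_k F k *+ inter_num D N j k i.
Proof.
move=> oui; rewrite (partition_big (ord_hdist u) predT) //=.
apply: eq_bigr => k _; rewrite (inter_numE j k oui) cardsE -sumr_const.
by apply: eq_bigr => v /andP[_ /eqP ->].
Qed.

End HammingDistance.

Section HammingHypergroup.
Variables (R : realType) (D N : nat).
Implicit Types (f : 'I_D.+1 -> R[i]) (i j : 'I_D.+1) (o u v : hvertex D N).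

Lemma hconv_spheres f i j o :
  hconv N f i j =
  ((omega D N i)%:R * (omega D N j)%:R)^-1 *
    \sum_(u | hdist o u == i) \sum_(v | hdist o v == j) f (ord_hdist u v).
Proof.
under eq_bigr => u /eqP oui do rewrite (sum_sphere_hdist _ _ oui).
rewrite sumr_sphere -sumrMnl mulr_sumr; apply: eq_bigr => k _.
rewrite -mulrnA mulnC -omega_inter_num -[_ *+ (_ * _)%N]mulr_natl natrM.
by rewrite /tilde_p !rmorphM /= fmorphV rmorphM !rmorph_nat; ring.
Qed.

Lemma hconv_sphere f i j o u :
  hdist o u = i ->
  hconv N f i j =
  (omega D N j)%:R^-1 * \sum_(v | hdist o v == j) f (ord_hdist u v).
Proof.
move=> oui; rewrite (hconv_spheres _ _ _ o) (sum_sphere_hdist _ _ oui).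
under eq_bigr => w /eqP owi do rewrite (sum_sphere_hdist _ _ owi).
have omega_i_neq0 : (omega D N i)%:R != 0 :> R[i].
  by rewrite pnatr_eq0 -lt0n -oui omega_hdist_gt0.
by rewrite sumr_sphere -[(\sum_k _) *+ _]mulr_natl invfM mulrACA mulVf // mul1r.
Qed.

Lemma hconvC f i j : hconv N f i j = hconv N f j i.
Proof.
apply: eq_bigr => k _.
by rewrite /tilde_p inter_numC [_%:R * (omega D N j)%:R]mulrC.
Qed.

Lemma kernel_psd_hg_posdef f :
  (0 < N)%N -> kernel_psd (fun u v => f (ord_hdist u v)) -> hg_posdef N f.
Proof.
move=> N_gt0 fpsd; pose o := origin D N_gt0.
pose w i u : R[i] := (hdist o u == i)%:R / (omega D N i)%:R.
have hconv_w i j :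
    hconv N f i j = \sum_u \sum_v w i u * (w j v)^* * f (ord_hdist u v).
  rewrite (hconv_spheres _ _ _ o) mulr_sumr big_mkcond.
  apply: eq_bigr => u _; rewrite mulr_sumr big_mkcond /w.
  case: eqP => _; last by rewrite big1 // => v _; rewrite !mul0r.
  apply: eq_bigr => v _; case: eqP => _; last first.
    by rewrite mul0r conjC0 mulr0 mul0r.
  by rewrite fmorph_div /= !rmorph_nat invfM !mul1r.
move=> n x c; under eq_bigr do under eq_bigr do rewrite hconv_w.
exact: kernel_psd_congruence.
Qed.

Hypothesis N_gt1 : (1 < N)%N.

Let o := origin D (ltnW N_gt1).

Lemma hconv0l f j : hconv N f ord0 j = f j.
Proof.
rewrite (hconv_sphere (i := ord0) _ _ (hdistxx o)).
rewrite (eq_bigr (fun=> f j)) => [|v /eqP ovj]; last first.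
  by congr f; exact: val_inj.
rewrite sumr_sphere -[f j *+ _]mulr_natl mulKf // pnatr_eq0 -lt0n.
by rewrite omega_gt0 ?leq_ord.
Qed.

(* The three-term recurrence of the polynomials behind the hypergroup. *)
Lemma hconv1r (g : nat -> R[i]) i j :
  j = 1%N :> nat ->
  hconv N (fun k : 'I_D.+1 => g k) i j =
  (g i.-1 *+ i + g i *+ (i * N.-2) + g i.+1 *+ ((D - i) * N.-1))
    / (D * N.-1)%:R.
Proof.
move=> j_eq1; have [u oui] := ex_hdist o N_gt1 (leq_ord i).
rewrite (hconv_sphere _ _ oui) j_eq1 omega1 1?ltnW //.
rewrite mulrC -oui -sum_neighbours; congr (_ / _).
by apply: eq_bigr => v _; rewrite hdist_sym.
Qed.

End HammingHypergroup.

Lemma equicorrelation_intervalE (R : realFieldType) (n x : R) :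
  0 < n -> (- 1 / n <= x <= 1) = (0 <= 1 - x) && (0 <= 1 + n * x).
Proof.
move=> n_gt0; rewrite ler_pdivrMr // subr_ge0 [x * n]mulrC.
by rewrite -lerBlDl sub0r andbC.
Qed.

(* The factors are not both negative, since [n (1 - x) + (1 + n x) > 0]. *)
Lemma equicorrelation_interval_mul (R : realFieldType) (n x : R) :
  0 < n -> 0 <= (1 - x) * (1 + n * x) -> - 1 / n <= x <= 1.
Proof.
move=> n_gt0; rewrite equicorrelation_intervalE //.
case: (ltrgtP 0 (1 - x)) => [mu_gt0|mu_lt0|mu_eq0] /=.
- by rewrite pmulr_rge0.
- by rewrite nmulr_rge0 // => la_le0; nra.
- by move=> _; rewrite (_ : x = 1); lra.
Qed.

Section ExponentialKernel.
Variables (R : realType) (N D : nat) (x : R).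
Hypothesis N_gt1 : (1 < N)%N.

Let N1_gt0 : 0 < N%:R - 1 :> R.
Proof. by rewrite subr_gt0 ltr1n. Qed.

Lemma expr_hdist_psd :
  - 1 / (N%:R - 1) <= x <= 1 ->
  kernel_psd (fun u v : hvertex D N => (x ^+ hdist u v)%:C).
Proof.
rewrite equicorrelation_intervalE // => /andP[mu_ge0 la_ge0].
apply: real_gram_psd; have := @real_gram_equicorrelation R 'I_N x mu_ge0.
rewrite card_ord => /(_ la_ge0)/(real_gram_tensor 'I_D)[S [g gE]].
by exists S, g => u v; rewrite expr_hdist gE.
Qed.

Local Notation f := (fun k : 'I_D.+1 => (x ^+ k)%:C).

Lemma hconv_expr11 (one : 'I_D.+1) :
  one = 1%N :> nat ->
  hconv N f one one = ((1 + (N%:R - 2) * x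
    + (D%:R - 1) * (N%:R - 1) * x ^+ 2) / (D%:R * (N%:R - 1)))%:C.
Proof.
move=> one_val.
rewrite (hconv1r N_gt1 (fun k => (x ^+ k)%:C) _ one_val) one_val.
rewrite -!rmorphMn -!rmorphD -fmorphV -rmorphM.
apply: (congr1 (real_complex R)).
have N1E : N.-1%:R = N%:R - 1 :> R by rewrite -subn1 natrB // ltnW.
have N2E : N.-2%:R = N%:R - 2 :> R by rewrite -subn2 natrB.
have D1E : (D - 1)%:R = D%:R - 1 :> R by rewrite natrB // -one_val -ltnS.
rewrite mulr1n mul1n -[x ^+ 1 *+ _]mulr_natl -[x ^+ 2 *+ _]mulr_natl.
by rewrite !natrM N1E N2E D1E.
Qed.

Lemma expr_hg_posdef_interval :
  (0 < D)%N -> hg_posdef N f -> - 1 / (N%:R - 1) <= x <= 1.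
Proof.
move=> D_gt0 fpd; apply: equicorrelation_interval_mul => //.
pose one : 'I_D.+1 := inord 1.
have one_val : one = 1%N :> nat by rewrite inordK.
have f00 : hconv N f ord0 ord0 = 1 by rewrite hconv0l.
have f01 : hconv N f ord0 one = x%:C by rewrite hconv0l // one_val.
have f10 : hconv N f one ord0 = x%:C by rewrite hconvC.
have := @kernel_psd_cauchy_schwarz _ _ (hconv N f) ord0 one fpd.
rewrite f00 f01 f10 hconv_expr11 // ltr01.
move=> /(_ isT (esym (conjc_real x))).
rewrite mul1r -rmorphM lecR ler_pdivlMr ?mulr_gt0 ?ltr0n // => det_ge0.
by lra.
Qed.

End ExponentialKernel.

Theorem theorem4p1 (R : realType) (N D : nat) (hN : (2 <= N)%N) (hD : (1 <= D)%N)
    (x : R) :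
  [<-> - 1 / (N%:R - 1) <= x <= 1 ;
       hg_posdef N (fun i : 'I_D.+1 => (x ^+ i)%:C) ;
       kernel_psd (fun u v : hvertex D N => (x ^+ hdist u v)%:C) ].
Proof.
have interval_psd := @expr_hdist_psd R N D x hN.
have psd_posdef := @kernel_psd_hg_posdef R D N (fun k => (x ^+ k)%:C) (ltnW hN).
have posdef_interval := @expr_hg_posdef_interval R N D x hN hD.
by tfae => [/interval_psd/psd_posdef|/posdef_interval/interval_psd|
  /psd_posdef/posdef_interval].
Qed.
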